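(* The provability logic $\mathsf{GL}$ is sound for provability models having necessitation and Löb's rule. Moreover, soundness still holds if necessitation is replaced by transitivity of the accessibility relation, and/or Löb's rule is replaced by converse well-foundedness of the accessibility relation. That is: if $\mathsf{GL}\vdash A$ and $\mathcal P$ is a provability model that (i) has necessitation or has transitive accessibility relation, and (ii) has Löb's rule or has converse well-founded accessibility relation, then $\mathcal P,w\Vdash A$ for every world $w$.
   Context: $\mathsf{GL}$ is $\mathsf K$ (the smallest normal modal logic) plus $\Box A\to\Box\Box A$ and $\Box(\Box A\to A)\to\Box A$. Language $\mathcal L_\Box$: formulas built from atomic propositions and $\bot$ using $\to$ and a unary $\Box$. A formula is purely modal if it is a Boolean combination of formulas $\Box B$. A theory is a pair of a set of axioms and a set of inference rules (finitely many premises, one conclusion); $\mathsf T\vdash A$ means derivability from axioms by rules. A theory is classical if modus ponens is one of its rules and all classical tautologies are derivable. A provability pre-model is $\mathcal P=(W,\sqsubset,\{L_w\}_{w\in W^\sqsubset},V)$ with $W$ nonempty, $\sqsubset$ a binary relation on $W$, $V\subseteq W\times\mathrm{atoms}$, $W^\sqsubset=\{u:\exists v\,(v\sqsubset u)\}$, and a theory $L_w$ for each $w\in W^\sqsubset$. Satisfaction: atoms via $V$, $\bot$ never holds, $\to$ classical, $\mathcal P,w\Vdash\Box A$ iff $L_u\vdash A$ for all $u$ with $w\sqsubset u$. With $\sqsubset^+$ the transitive closure, $\mathcal P,w\Vdash^+A$ iff there is $u\sqsubset w$ with $\mathcal P,v\Vdash A$ for all $v$ such that $u\sqsubset^+v$.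 A provability model is a pre-model in which every $L_w$ is classical and which satisfies modal completeness: for every $w\in W^\sqsubset$ and purely modal $A$, $\mathcal P,w\Vdash^+A$ implies $L_w\vdash A$. Necessitation: every $L_w$ has the rule ''from $A$ infer $\Box A$''; Löb's rule: every $L_w$ has the rule ''from $\Box A\to A$ infer $A$''. Converse well-founded: there is no infinite chain $w_0\sqsubset w_1\sqsubset w_2\sqsubset\cdots$. *)

(* Defs.v *)
From Stdlib Require Import List Relations.
Import ListNotations.
Set Implicit Arguments.

Inductive form (atom : Type) : Type :=
| Atom : atom -> form atom
| Bot : form atom
| Imp : form atom -> form atom -> form atom
| Box : form atom -> form atom.

Arguments Bot {atom}.

(* Boolean combinations; [Bot] and [Imp] generate all Boolean connectives. *)
Inductive purely_modal (atom : Type) : form atom -> Prop :=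
| pm_Box : forall B, purely_modal (Box B)
| pm_Bot : purely_modal Bot
| pm_Imp : forall B C,
    purely_modal B -> purely_modal C -> purely_modal (Imp B C).

(* Atoms and boxed formulas are both treated as propositional variables. *)
Fixpoint bool_eval (atom : Type) (v : form atom -> bool) (A : form atom)
  : bool :=
  match A with
  | Atom _ => v A
  | Bot => false
  | Imp B C => implb (bool_eval v B) (bool_eval v C)
  | Box _ => v A
  end.

Definition tautology (atom : Type) (A : form atom) : Prop :=
  forall v : form atom -> bool, bool_eval v A = true.

(* A concrete rule instance; a rule scheme such as "from A infer Box A"
   is the set of all its instances. *)
Record rule (atom : Type) : Type := Rule {
  premises : list (form atom);
  conclusion : form atom
}.

Record theory (atom : Type) : Type := Theory {
  axioms : form atom -> Prop;
  rules : rule atom -> Prop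
}.

Inductive derivable (atom : Type) (T : theory atom) : form atom -> Prop :=
| der_axiom : forall A, axioms T A -> derivable T A
| der_rule : forall r,
    rules T r ->
    (forall A, In A (premises r) -> derivable T A) ->
    derivable T (conclusion r).

Definition modus_ponens (atom : Type) (A B : form atom) : rule atom :=
  Rule [Imp A B; A] B.

Definition necessitation (atom : Type) (A : form atom) : rule atom :=
  Rule [A] (Box A).

Definition loeb_rule (atom : Type) (A : form atom) : rule atom :=
  Rule [Imp (Box A) A] A.

Definition classical_theory (atom : Type) (T : theory atom) : Prop :=
  (forall A B, rules T (modus_ponens A B)) /\
  (forall A, tautology A -> derivable T A).

Inductive K_axiom (atom : Type) : form atom -> Prop :=
| K_taut : forall A, tautology A -> K_axiom A
| K_dist : forall A B,
    K_axiom (Imp (Box (Imp A B)) (Imp (Box A) (Box B))).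

Inductive GL_axiom (atom : Type) : form atom -> Prop :=
| GL_K : forall A, K_axiom A -> GL_axiom A
| GL_4 : forall A, GL_axiom (Imp (Box A) (Box (Box A)))
| GL_L : forall A, GL_axiom (Imp (Box (Imp (Box A) A)) (Box A)).

Inductive normal_rule (atom : Type) : rule atom -> Prop :=
| normal_mp : forall A B, normal_rule (modus_ponens A B)
| normal_nec : forall A, normal_rule (necessitation A).

(* The axioms are schemes, so closure under substitution is built in. *)
Definition GL (atom : Type) : theory atom :=
  Theory (@GL_axiom atom) (@normal_rule atom).

Definition accessible (W : Type) (R : W -> W -> Prop) : Type :=
  {u : W | exists v, R v u}.

Record premodel (atom : Type) : Type := Premodel {
  world : Type;
  world_inhabited : inhabited world;
  acc : world -> world -> Prop;
  thy : accessible acc -> theory atom;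
  val : world -> atom -> Prop
}.

Fixpoint sat (atom : Type) (P : premodel atom) (w : world P) (A : form atom)
  : Prop :=
  match A with
  | Atom p => val P w p
  | Bot => False
  | Imp B C => sat P w B -> sat P w C
  | Box B => forall u : accessible (acc P),
      acc P w (proj1_sig u) -> derivable (thy P u) B
  end.

Definition sat_plus (atom : Type) (P : premodel atom) (w : world P)
    (A : form atom) : Prop :=
  exists u, acc P u w /\
    forall v, clos_trans (world P) (acc P) u v -> sat P v A.

Definition modally_complete (atom : Type) (P : premodel atom) : Prop :=
  forall (w : accessible (acc P)) (A : form atom),
    purely_modal A -> sat_plus P (proj1_sig w) A -> derivable (thy P w) A.

Definition provability_model (atom : Type) (P : premodel atom) : Prop :=
  (forall w, classical_theory (thy P w)) /\ modally_complete P.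

Definition has_necessitation (atom : Type) (P : premodel atom) : Prop :=
  forall w A, rules (thy P w) (necessitation A).

Definition has_loeb_rule (atom : Type) (P : premodel atom) : Prop :=
  forall w A, rules (thy P w) (loeb_rule A).

Definition converse_well_founded (W : Type) (R : W -> W -> Prop) : Prop :=
  ~ exists f : nat -> W, forall n, R (f n) (f (S n)).

(* Main.v *)
Require Import Defs.
From Stdlib Require Import Relations Wellfounded.
From Stdlib Require Import Classical ClassicalEpsilon.

(** By induction on the GL-derivation, every theorem of GL holds at every world
    and is derivable in every [thy P u]; for purely modal formulas the second
    property follows from the first by modal completeness.  When the relation is
    converse well-founded, the Löb axiom at [w] is obtained by induction along
    the transitive closure of the converse relation: with [B := Box A -> A], the
    induction hypothesis and modal completeness give [Box B -> Box A] in every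
    theory visible from [w], axiom 4 gives [Box B] there, and so [Box A] and [A]
    are derivable. *)

(** Classically, a non-accessible point has a non-accessible [R]-successor; choosing one each time
    and iterating gives an infinite chain. *)
Lemma converse_well_founded_wf (W : Type) (R : W -> W -> Prop) :
  converse_well_founded R -> well_founded (transp W R).
Proof.
  intros cwf x. apply NNPP. intro Hx.
  assert (step : forall a : {a | ~ Acc (transp W R) a},
             {b : {b | ~ Acc (transp W R) b} | R (proj1_sig a) (proj1_sig b)}).
  { intros [a Ha]. apply constructive_indefinite_description.
    apply NNPP. intro Hno. apply Ha. constructor. intros b Hb.
    apply NNPP. intro Hnb. apply Hno. exists (exist _ b Hnb). exact Hb. }
  apply cwf.
  exists (fun n => proj1_sig
            (nat_rect _ (exist _ x Hx) (fun _ a => proj1_sig (step a)) n)).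
  intro n. simpl.
  exact (proj2_sig (step (nat_rect _ (exist _ x Hx)
                            (fun _ a => proj1_sig (step a)) n))).
Qed.

Lemma derivable_mp (atom : Type) (T : theory atom) (A B : form atom) :
  rules T (modus_ponens A B) ->
  derivable T (Imp A B) -> derivable T A -> derivable T B.
Proof.
  intros Hr HAB HA. apply (der_rule (modus_ponens A B) Hr).
  intros C [<- | [<- | []]]; assumption.
Qed.

Lemma derivable_nec (atom : Type) (T : theory atom) (A : form atom) :
  rules T (necessitation A) -> derivable T A -> derivable T (Box A).
Proof.
  intros Hr HA. apply (der_rule (necessitation A) Hr).
  intros C [<- | []]; assumption.
Qed.

Lemma derivable_loeb (atom : Type) (T : theory atom) (A : form atom) :
  rules T (loeb_rule A) -> derivable T (Imp (Box A) A) -> derivable T A.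
Proof.
  intros Hr HA. apply (der_rule (loeb_rule A) Hr).
  intros C [<- | []]; assumption.
Qed.

(** Satisfaction at [w] respects [Bot] and [Imp], so it is itself a Boolean valuation; excluded
    middle makes it [bool]-valued. *)
Lemma sat_tautology (atom : Type) (P : premodel atom) (w : world P)
    (A : form atom) :
  tautology A -> sat P w A.
Proof.
  pose (v := fun B => if excluded_middle_informative (sat P w B)
                      then true else false).
  assert (Hv : forall B, v B = true <-> sat P w B).
  { intro B. unfold v.
    destruct (excluded_middle_informative (sat P w B)); intuition congruence. }
  assert (truth : forall B, bool_eval v B = true <-> sat P w B).
  { induction B as [p | | B IHB C IHC | B _].
    - apply Hv.
    - simpl. intuition congruence.
    - simpl. rewrite <- IHB, <- IHC.
      destruct (bool_eval v B), (bool_eval v C); simpl; intuition congruence.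
    - apply Hv. }
  intro HA. apply truth, HA.
Qed.

Section ProvabilityModel.

Variables (atom : Type) (P : premodel atom).
Hypothesis modelP : provability_model P.

Lemma thy_mp (u : accessible (acc P)) (A B : form atom) :
  derivable (thy P u) (Imp A B) -> derivable (thy P u) A ->
  derivable (thy P u) B.
Proof. apply derivable_mp, (proj1 modelP). Qed.

Lemma valid_purely_modal_derivable (A : form atom) :
  purely_modal A -> (forall w, sat P w A) ->
  forall u, derivable (thy P u) A.
Proof.
  intros pmA HA u. apply (proj2 modelP); [exact pmA |].
  (* A world carrying a theory has a predecessor, the witness for [sat_plus]. *)
  destruct (proj2_sig u) as [w Hw]. exists w. auto.
Qed.

Lemma sat_K (w : world P) (A B : form atom) :
  sat P w (Imp (Box (Imp A B)) (Imp (Box A) (Box B))).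
Proof.
  intros HAB HA u Hu. apply thy_mp with A; [exact (HAB u Hu) | exact (HA u Hu)].
Qed.

Hypothesis nec_or_trans :
  has_necessitation P \/ transitive (world P) (acc P).

Lemma sat_4 (w : world P) (A : form atom) :
  sat P w (Imp (Box A) (Box (Box A))).
Proof.
  intros HA u Hu. destruct nec_or_trans as [nec | trans].
  - apply derivable_nec; [apply nec | exact (HA u Hu)].
  (* By transitivity, worlds reachable from [w] see only successors of [w], so they inherit
     [Box A]. *)
  - apply (proj2 modelP); [constructor |].
    exists w. split; [exact Hu |]. intros v Hv x Hx. apply HA.
    assert (Hwv : acc P w v) by (clear - trans Hv; unfold transitive in trans;
      induction Hv; eauto).
    exact (trans _ _ _ Hwv Hx).
Qed.

Hypothesis loeb_or_cwf : has_loeb_rule P \/ converse_well_founded (acc P).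

Lemma sat_loeb (w : world P) (A : form atom) :
  sat P w (Imp (Box (Imp (Box A) A)) (Box A)).
Proof.
  destruct loeb_or_cwf as [loeb | cwf].
  - intros HA u Hu. apply derivable_loeb; [apply loeb | exact (HA u Hu)].
  (* Induction along the closure covers all [v] reachable from [w], as [sat_plus] demands. *)
  - induction w as [w IH] using
      (well_founded_ind (wf_clos_trans _ _ (converse_well_founded_wf _ _ cwf))).
    intros HA u Hu.
    apply thy_mp with (Box A); [exact (HA u Hu) |].
    apply thy_mp with (Box (Imp (Box A) A)).
    + apply (proj2 modelP); [repeat constructor |].
      exists w. split; [exact Hu |]. intros v Hv. apply IH.
      apply clos_trans_transp_permute. exact Hv.
    + exact (sat_4 w _ HA u Hu).
Qed.

(** Validity alone is too weak for induction: [Box B] requires [B] to be derivable in the theories,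
    and modal completeness yields this only for purely modal [B]. *)
Lemma GL_valid_and_derivable (A : form atom) :
  derivable (GL atom) A ->
  (forall w, sat P w A) /\ (forall u, derivable (thy P u) A).
Proof.
  assert (valid_pm : forall B, purely_modal B -> (forall w, sat P w B) ->
            (forall w, sat P w B) /\ (forall u, derivable (thy P u) B)).
  { intros B pmB HB. split; [exact HB |].
    apply valid_purely_modal_derivable; assumption. }
  induction 1 as [A HA | r Hr _ IH].
  - destruct HA as [A [B HB | B C] | A | A].
    + split; [intro w; apply sat_tautology, HB | intro u].
      apply (proj1 modelP), HB.
    + apply valid_pm; [repeat constructor | intro w; apply sat_K].
    + apply valid_pm; [repeat constructor | intro w; apply sat_4].
    + apply valid_pm; [repeat constructor | intro w; apply sat_loeb].
  - destruct Hr as [B C | B]; simpl in *.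
    + destruct (IH (Imp B C)) as [HBC dBC]; [auto |].
      destruct (IH B) as [HB dB]; [auto |].
      split; [intro w; exact (HBC w (HB w)) | intro u].
      apply thy_mp with B; auto.
    + destruct (IH B) as [_ dB]; [auto |].
      (* Derivability of [Box B] comes from modal completeness, so the theories need not have the
         necessitation rule. *)
      apply (valid_pm (Box B)); [constructor | intros w u _; apply dB].
Qed.

End ProvabilityModel.

Theorem theorem3p14 (atom : Type) (A : form atom) (P : premodel atom) :
  derivable (GL atom) A ->
  provability_model P ->
  has_necessitation P \/ transitive (world P) (acc P) ->
  has_loeb_rule P \/ converse_well_founded (acc P) ->
  forall w : world P, sat P w A.
Proof.
  intros HA modelP H4 HL.
  exact (proj1 (GL_valid_and_derivable _ _ modelP H4 HL A HA)).
Qed.
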